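(* Suppose that $g$ is independent of the upper-level variable $x$, i.e. $g(x,y)=g(y)$. Let $\lambda>0$ and let $\bar\zeta=(\bar x,\bar y,\bar z,\bar u,\bar v,\bar w)\in\mathbb{R}^n\times\mathbb{R}^m\times\mathbb{R}^m\times\mathbb{R}^p\times\mathbb{R}^q\times\mathbb{R}^q$ satisfy the stationarity system with parameter $\lambda$. Assume that (i) the family $\{\nabla_x G_j(\bar x,\bar y): G_j(\bar x,\bar y)=0\}$ of partial gradients with respect to $x$ is linearly independent; (ii) (LLICQ at $\bar y$ and at $\bar z$) the families $\{\nabla g_j(\bar y): g_j(\bar y)=0\}$ and $\{\nabla g_j(\bar z): g_j(\bar z)=0\}$ are each linearly independent; (iii) for all $d\in Q(\bar x,\bar y,\bar z)\setminus\{0\}$, $$(d^{1,2})^\top\nabla^2\mathcal{L}^\lambda(\bar\zeta)\,d^{1,2}>\lambda\,(d^{1,3})^\top\nabla^2\ell^*(\bar\zeta)\,d^{1,3},\qquad\text{where}\quad \nabla^2\ell^*(\bar\zeta):=\begin{bmatrix}\nabla^2_1\ell(\bar\zeta)&\nabla^2_{21}\ell(\bar\zeta)\\-\nabla^2_{12}\ell(\bar\zeta)&-\nabla^2_2\ell(\bar\zeta)\end{bmatrix}.$$ Then $\Phi^\lambda$ is CD-regular at $\bar\zeta$, i.e., every matrix in the Clarke generalized Jacobian $\partial\Phi^\lambda(\bar\zeta)$ is nonsingular.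
   Context: The functions $F,f:\mathbb{R}^n\times\mathbb{R}^m\to\mathbb{R}$, $G:\mathbb{R}^n\times\mathbb{R}^m\to\mathbb{R}^p$ and $g$ (with values in $\mathbb{R}^q$) are twice continuously differentiable. Here $g$ depends only on the lower-level variable in $\mathbb{R}^m$. Define $\ell(x,z,w):=f(x,z)+w^\top g(z)$, $\mathcal{L}^\lambda(x,y,u,v):=F(x,y)+u^\top G(x,y)+v^\top g(y)+\lambda f(x,y)$, and $L^\lambda(x,y,z,u,v,w):=\mathcal{L}^\lambda(x,y,u,v)-\lambda\ell(x,z,w)$. $\nabla^2\mathcal{L}^\lambda(\bar\zeta)$ is the Hessian of $\mathcal{L}^\lambda$ with respect to $(x,y)$ at $(\bar x,\bar y,\bar u,\bar v)$. All derivatives of $\ell$ are taken at $(\bar x,\bar z,\bar w)$: $\nabla^2_1\ell\in\mathbb{R}^{n\times n}$ and $\nabla^2_2\ell\in\mathbb{R}^{m\times m}$ are the Hessians with respect to $x$ and to $z$, $\nabla^2_{12}\ell\in\mathbb{R}^{m\times n}$ is the matrix with entries $\partial^2\ell/\partial z_i\partial x_k$, and $\nabla^2_{21}\ell=(\nabla^2_{12}\ell)^\top\in\mathbb{R}^{n\times m}$. Stationarity system with parameter $\lambda$ (for $(x,y,z,u,v,w)$): $\nabla_{(x,y,z)}L^\lambda(x,y,z,u,v,w)=0$; $u\ge0$, $G(x,y)\le0$, $u^\top G(x,y)=0$; $v\ge0$, $g(y)\le0$, $v^\top g(y)=0$; $w\ge0$, $g(z)\le0$, $w^\top g(z)=0$.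 With $\phi(a,b):=\sqrt{a^2+b^2}-a-b$ put $\phi^G(x,y,u):=(\phi(-G_i(x,y),u_i))_{i=1}^p$ and $\phi^g(y,v):=(\phi(-g_j(y),v_j))_{j=1}^q$. With $N:=n+2m+p+2q$ and $\zeta=(x,y,z,u,v,w)$, the map $\Phi^\lambda:\mathbb{R}^N\to\mathbb{R}^N$ is $$\Phi^\lambda(\zeta):=\big(\nabla_{(x,y,z)}L^\lambda(\zeta),\ \phi^G(x,y,u),\ \phi^g(y,v),\ \phi^g(z,w)\big).$$ The Clarke generalized Jacobian $\partial\Phi^\lambda(\bar\zeta)$ is the convex hull of all limits of Jacobians of $\Phi^\lambda$ along sequences of differentiability points converging to $\bar\zeta$. Index sets: $\nu^1:=\{i\mid\bar u_i>0,\,G_i(\bar x,\bar y)=0\}$, $\nu^2:=\{j\mid\bar v_j>0,\,g_j(\bar y)=0\}$, $\nu^3:=\{j\mid\bar w_j>0,\,g_j(\bar z)=0\}$. For $d=(d^1,d^2,d^3)\in\mathbb{R}^n\times\mathbb{R}^m\times\mathbb{R}^m$ write $d^{1,2}:=(d^1,d^2)$, $d^{1,3}:=(d^1,d^3)$, and $$Q(\bar x,\bar y,\bar z):=\{d\mid\nabla G_i(\bar x,\bar y)^\top d^{1,2}=0\ (i\in\nu^1),\ \nabla g_j(\bar y)^\top d^2=0\ (j\in\nu^2),\ \nabla g_j(\bar z)^\top d^3=0\ (j\in\nu^3)\}.$$ *)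

(* Defs.v *)
From HB Require Import structures.
From mathcomp Require Import all_boot all_order all_algebra.
From mathcomp Require Import all_classical all_reals all_analysis.
Set Implicit Arguments.
Unset Strict Implicit.
Unset Printing Implicit Defensive.
Import Order.TTheory GRing.Theory Num.Theory.
Import numFieldNormedType.Exports.
Local Open Scope classical_set_scope.
Local Open Scope ring_scope.

(* Vectors of R^k are row vectors, and R^n x R^m is identified with R^(n + m)
   through [row_mx]. *)

Section Calculus.
Context {R : realType}.

Definition dot k (a b : 'rV[R]_k) : R := \sum_i a 0 i * b 0 i.

Definition quad k (H : 'M[R]_k) (d : 'rV[R]_k) : R := (d *m H *m d^T) 0 0.

Definition partial k (i : 'I_k) (h : 'rV[R]_k -> R) (x : 'rV[R]_k) : R :=
  'D_(delta_mx 0 i) h x.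

Definition grad k (h : 'rV[R]_k -> R) (x : 'rV[R]_k) : 'rV[R]_k :=
  \row_i partial i h x.

Definition hess k (h : 'rV[R]_k -> R) (x : 'rV[R]_k) : 'M[R]_k :=
  \matrix_(i, j) partial i (partial j h) x.

Definition C1 k (h : 'rV[R]_k -> R) : Prop :=
  (forall x, differentiable h x) /\ (forall i, continuous (partial i h)).

Definition C2 k (h : 'rV[R]_k -> R) : Prop :=
  C1 h /\ (forall i, C1 (partial i h)).

Definition C2_vec k l (h : 'rV[R]_k -> 'rV[R]_l) : Prop :=
  forall j, C2 (fun x => h x 0 j).

(* The library's ['J h x] acts on row vectors by right multiplication; the
   usual l x k Jacobian matrix is its transpose. *)
Definition jac k l (h : 'rV[R]_k -> 'rV[R]_l) (x : 'rV[R]_k) : 'M[R]_(l, k) :=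
  ('J h x)^T.

Definition limiting_jacobians k l (h : 'rV[R]_k -> 'rV[R]_l) (x : 'rV[R]_k) :
    set 'M[R]_(l, k) :=
  [set M | exists s : nat -> 'rV[R]_k,
     [/\ s t @[t --> \oo] --> x,
         forall t, differentiable h (s t) &
         jac h (s t) @[t --> \oo] --> M]].

Definition convex_hull k l (A : set 'M[R]_(l, k)) : set 'M[R]_(l, k) :=
  smallest (@convex_set R 'M[R]_(l, k)) A.

Definition clarke_jacobian k l (h : 'rV[R]_k -> 'rV[R]_l) (x : 'rV[R]_k) :
    set 'M[R]_(l, k) :=
  convex_hull (limiting_jacobians h x).

Definition CD_regular k (h : 'rV[R]_k -> 'rV[R]_k) (x : 'rV[R]_k) : Prop :=
  forall M, clarke_jacobian h x M -> M \in unitmx.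

(* a >= 0, b <= 0, a^T b = 0 *)
Definition complementary k (a b : 'rV[R]_k) : Prop :=
  [/\ forall i, 0 <= a 0 i, forall i, b 0 i <= 0 & dot a b = 0].

Definition active k (c : 'rV[R]_k) : {set 'I_k} := [set j | c 0 j == 0].

Definition strongly_active k (a c : 'rV[R]_k) : {set 'I_k} :=
  [set j | (0 < a 0 j) && (c 0 j == 0)].

Definition fischer_burmeister (a b : R) : R :=
  Num.sqrt (a ^+ 2 + b ^+ 2) - a - b.

Definition fb_vec k (c a : 'rV[R]_k) : 'rV[R]_k :=
  \row_j fischer_burmeister (- c 0 j) (a 0 j).

End Calculus.

Section Bilevel.
Context {R : realType} {n m p q : nat}.
Context (F f : 'rV[R]_(n + m) -> R).
Context (G : 'rV[R]_(n + m) -> 'rV[R]_p) (g : 'rV[R]_m -> 'rV[R]_q).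

Definition ell (x : 'rV[R]_n) (z : 'rV[R]_m) (w : 'rV[R]_q) : R :=
  f (row_mx x z) + dot w (g z).

Definition calL (lam : R) (x : 'rV[R]_n) (y : 'rV[R]_m)
    (u : 'rV[R]_p) (v : 'rV[R]_q) : R :=
  F (row_mx x y) + dot u (G (row_mx x y)) + dot v (g y)
  + lam * f (row_mx x y).

Definition bigL (lam : R) (x : 'rV[R]_n) (y z : 'rV[R]_m)
    (u : 'rV[R]_p) (v w : 'rV[R]_q) : R :=
  calL lam x y u v - lam * ell x z w.

Definition grad_bigL (lam : R) (x : 'rV[R]_n) (y z : 'rV[R]_m)
    (u : 'rV[R]_p) (v w : 'rV[R]_q) : 'rV[R]_(n + m + m) :=
  grad (fun s : 'rV[R]_(n + m + m) =>
          bigL lam (lsubmx (lsubmx s)) (rsubmx (lsubmx s)) (rsubmx s) u v w)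
       (row_mx (row_mx x y) z).

Definition stationary (lam : R) (x : 'rV[R]_n) (y z : 'rV[R]_m)
    (u : 'rV[R]_p) (v w : 'rV[R]_q) : Prop :=
  [/\ grad_bigL lam x y z u v w = 0,
      complementary u (G (row_mx x y)),
      complementary v (g y) &
      complementary w (g z)].

Definition zeta_vec (x : 'rV[R]_n) (y z : 'rV[R]_m)
    (u : 'rV[R]_p) (v w : 'rV[R]_q) : 'rV[R]_(n + m + m + (p + q + q)) :=
  row_mx (row_mx (row_mx x y) z) (row_mx (row_mx u v) w).

Definition Phi (lam : R) (zeta : 'rV[R]_(n + m + m + (p + q + q))) :
    'rV[R]_(n + m + m + (p + q + q)) :=
  let x := lsubmx (lsubmx (lsubmx zeta)) in
  let y := rsubmx (lsubmx (lsubmx zeta)) in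
  let z := rsubmx (lsubmx zeta) in
  let u := lsubmx (lsubmx (rsubmx zeta)) in
  let v := rsubmx (lsubmx (rsubmx zeta)) in
  let w := rsubmx (rsubmx zeta) in
  row_mx (grad_bigL lam x y z u v w)
    (row_mx (row_mx (fb_vec (G (row_mx x y)) u) (fb_vec (g y) v))
            (fb_vec (g z) w)).

Definition hess_calL (lam : R) (x : 'rV[R]_n) (y : 'rV[R]_m)
    (u : 'rV[R]_p) (v : 'rV[R]_q) : 'M[R]_(n + m) :=
  hess (fun s : 'rV[R]_(n + m) => calL lam (lsubmx s) (rsubmx s) u v)
       (row_mx x y).

Definition hess1_ell (x : 'rV[R]_n) (z : 'rV[R]_m) (w : 'rV[R]_q) : 'M[R]_n :=
  hess (fun x' => ell x' z w) x.

Definition hess2_ell (x : 'rV[R]_n) (z : 'rV[R]_m) (w : 'rV[R]_q) : 'M[R]_m :=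
  hess (fun z' => ell x z' w) z.

Definition hess12_ell (x : 'rV[R]_n) (z : 'rV[R]_m) (w : 'rV[R]_q) :
    'M[R]_(m, n) :=
  \matrix_(i, k) partial i (fun z' => partial k (fun x' => ell x' z' w) x) z.

Definition hess21_ell (x : 'rV[R]_n) (z : 'rV[R]_m) (w : 'rV[R]_q) :
    'M[R]_(n, m) :=
  (hess12_ell x z w)^T.

Definition hess_ell_star (x : 'rV[R]_n) (z : 'rV[R]_m) (w : 'rV[R]_q) :
    'M[R]_(n + m) :=
  block_mx (hess1_ell x z w)      (hess21_ell x z w)
           (- hess12_ell x z w) (- hess2_ell x z w).

Definition d12 (d : 'rV[R]_(n + m + m)) : 'rV[R]_(n + m) := lsubmx d.
Definition d2 (d : 'rV[R]_(n + m + m)) : 'rV[R]_m := rsubmx (lsubmx d).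
Definition d3 (d : 'rV[R]_(n + m + m)) : 'rV[R]_m := rsubmx d.
Definition d13 (d : 'rV[R]_(n + m + m)) : 'rV[R]_(n + m) :=
  row_mx (lsubmx (lsubmx d)) (rsubmx d).

Definition Qset (x : 'rV[R]_n) (y z : 'rV[R]_m)
    (u : 'rV[R]_p) (v w : 'rV[R]_q) : set 'rV[R]_(n + m + m) :=
  [set d |
    [/\ forall i, i \in strongly_active u (G (row_mx x y)) ->
          dot (grad (fun s => G s 0 i) (row_mx x y)) (d12 d) = 0,
        forall j, j \in strongly_active v (g y) ->
          dot (grad (fun s => g s 0 j) y) (d2 d) = 0 &
        forall j, j \in strongly_active w (g z) ->
          dot (grad (fun s => g s 0 j) z) (d3 d) = 0]].

Definition upper_x_LICQ (x : 'rV[R]_n) (y : 'rV[R]_m) : Prop :=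
  free [seq grad (fun x' => G (row_mx x' y) 0 j) x
       | j in active (G (row_mx x y))].

Definition LLICQ (y : 'rV[R]_m) : Prop :=
  free [seq grad (fun s => g s 0 j) y | j in active (g y)].

End Bilevel.

(* Main.v *)
Require Import Defs.
From HB Require Import structures.
From mathcomp Require Import all_boot all_order all_algebra.
From mathcomp Require Import all_classical all_reals all_analysis.
From mathcomp Require Import ring lra.
Set Implicit Arguments.
Unset Strict Implicit.
Unset Printing Implicit Defensive.
Import Order.TTheory GRing.Theory Num.Theory.
Import numFieldNormedType.Exports.
Local Open Scope classical_set_scope.
Local Open Scope ring_scope.

(* Stacking [s = (x, y, z)], [mu = (u, v, w)] and [c = (G, g, g)], the map is
   [Phi (s, mu) = (grad_s (A + sum_j sg_j mu_j c_j) (s), phi (- c_j s, mu_j))]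
   with weights [sg = (1, 1, - lam)].  At a point of differentiability no pair
   [(- c_j, mu_j)] vanishes, so the Jacobian is
   [[H, J^T diag sg], [- diag al J, diag be]] with [(al_j + 1, be_j + 1)] on the
   unit circle.  The gradient rows are C1, and the coefficients pass to the
   limit because active gradients do not vanish; what survives both limits and
   convex combinations is [al, be <= 0], [al + be <= - 1/2], [al_j = 0] where
   [c_j < 0] and [be_j = 0] where [mu_j > 0].  If such a matrix kills [(d, e)],
   testing the first block row with [(d1, d2, - d3)] gives
   [d12 H_calL d12 - lam d13 H_ell* d13 + sum_j |sg_j| e_j (grad c_j . d) = 0],
   whose last sum is nonnegative by the remaining rows, while those rows also
   put [d] in [Q]; hence [d = 0] and then [e = 0] by linear independence.  The
   mixed terms of [ell] cancel by symmetry of second derivatives. *)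

(** * Directional derivatives and the calculus of C1 and C2 functions on row vectors *)

Section Partial.
Context {R : realType}.

(** A directional derivative sees only the values along one line, so every slicing, translation or
    linear substitution below reduces to comparing two lines. *)
Lemma eq_derive (U V : normedModType R) (f : U -> R) (h : V -> R) x y d e :
  (forall t : R, f (t *: d + x) = h (t *: e + y)) -> 'D_d f x = 'D_e h y.
Proof.
move=> fh; have := fh 0; rewrite !scale0r !add0r => fh0.
rewrite /derive (_ : (fun _ => _) =
  (fun t => t^-1 *: ((h \o shift y) (t *: e) - h y)))//.
by apply/funext => t /=; rewrite fh fh0.
Qed.

Lemma derive_mulmxr k l (P : 'M[R]_(k, l)) (h : 'rV[R]_l -> R) s e :
  'D_e (fun s => h (s *m P)) s = 'D_(e *m P) h (s *m P).
Proof. by apply: eq_derive => t; rewrite mulmxDl scalemxAl. Qed.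

Lemma derive_line k (h : 'rV[R]_k -> R) x e (t : R) :
  'D_1 (fun t : R => h (x + t *: e)) t = 'D_e h (x + t *: e).
Proof. by apply: eq_derive => r; rewrite scaler1 scalerDl addrCA. Qed.

Lemma derivable_line k (h : 'rV[R]_k -> R) x e (t : R) :
  derivable h (x + t *: e) e -> derivable (fun t : R => h (x + t *: e)) t 1.
Proof.
rewrite /derivable => dh; rewrite (_ : (fun _ => _) =
  (fun r => r^-1 *: ((h \o shift (x + t *: e)) (r *: e) - h (x + t *: e))))//.
by apply/funext => r /=; rewrite scaler1 scalerDl addrCA.
Qed.

Lemma partial_lshift k l (j : 'I_k) (h : 'rV[R]_(k + l) -> R) a b :
  partial (lshift l j) h (row_mx a b) = partial j (fun s => h (row_mx s b)) a.
Proof.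
apply: eq_derive => r.
by rewrite delta_mx_lshift scale_row_mx add_row_mx scaler0 add0r.
Qed.

Lemma partial_rshift k l (j : 'I_l) (h : 'rV[R]_(k + l) -> R) a b :
  partial (rshift k j) h (row_mx a b) = partial j (fun s => h (row_mx a s)) b.
Proof.
apply: eq_derive => r.
by rewrite delta_mx_rshift scale_row_mx add_row_mx scaler0 add0r.
Qed.

Lemma derive_grad k (h : 'rV[R]_k -> R) x e : differentiable h x ->
  'D_e h x = dot (grad h x) e.
Proof.
move=> dh; rewrite deriveE// [in LHS](row_sum_delta e) linear_sum /dot.
by apply: eq_bigr => i _; rewrite linearZ /= -deriveE// mxE mulrC.
Qed.

Lemma differentiable_mulmxr k l (P : 'M[R]_(k, l)) (s : 'rV[R]_k) :
  differentiable (fun s : 'rV[R]_k => s *m P) s.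
Proof.
rewrite [X in differentiable X _](_ : _ =
    \sum_i (fun s : 'rV[R]_k => s 0 i *: row i P)); last first.
  by apply/funext => r; rewrite mulmx_sum_row fct_sumE.
apply: differentiable_sum => i; apply: differentiableZl; exact: differentiable_coord.
Qed.

Lemma partialD k i (f h : 'rV[R]_k -> R) x :
  differentiable f x -> differentiable h x ->
  partial i (fun x => f x + h x) x = partial i f x + partial i h x.
Proof. by move=> df dh; apply: deriveD; exact: diff_derivable. Qed.

Lemma partialZ k i a (f : 'rV[R]_k -> R) x :
  differentiable f x -> partial i (fun x => a * f x) x = a * partial i f x.
Proof. by move=> df; apply: deriveZ; exact: diff_derivable. Qed.

Lemma partialM k i (f h : 'rV[R]_k -> R) x :
  differentiable f x -> differentiable h x ->
  partial i (fun x => f x * h x) x = f x * partial i h x + h x * partial i f x.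
Proof. by move=> df dh; apply: deriveM; exact: diff_derivable. Qed.

Lemma partial_sum k i l (f : 'I_l -> 'rV[R]_k -> R) x :
  (forall j, differentiable (f j) x) ->
  partial i (fun x => \sum_j f j x) x = \sum_j partial i (f j) x.
Proof.
move=> df; rewrite (_ : (fun x => _) = \sum_j f j).
  by apply: derive_sum => j; exact: diff_derivable.
by apply/funext => y; rewrite fct_sumE.
Qed.

Lemma partial_coord k i j (x : 'rV[R]_k) :
  partial i (fun x : 'rV[R]_k => x 0 j) x = (i == j)%:R.
Proof.
have /diff_derivable did : differentiable (@id 'rV[R]_k) x by [].
have := derive_id x (delta_mx 0 i); rewrite derive_mx// => /rowP/(_ j).
by rewrite !mxE eqxx eq_sym.
Qed.

Lemma partial_cst k i (a : R) (x : 'rV[R]_k) : partial i (fun=> a) x = 0.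
Proof. exact: derive_cst. Qed.

(** Blocks such as [(x, y)] or [(x, z)] are read off by a constant matrix [P], so this linear chain
    rule serves for all substitutions below. *)
Lemma partial_mulmxr k l (P : 'M[R]_(k, l)) (h : 'rV[R]_l -> R) i s :
  differentiable h (s *m P) ->
  partial i (fun s => h (s *m P)) s = \sum_j P i j * partial j h (s *m P).
Proof.
move=> dh; rewrite /partial derive_mulmxr derive_grad// /dot.
by apply: eq_bigr => j _; rewrite -rowE !mxE mulrC.
Qed.

Lemma C1_cst k a : C1 (fun=> a : R) (k := k).
Proof.
split=> [x|i]; first exact: differentiable_cst.
rewrite [partial i _](_ : _ = cst 0); first by apply: cst_continuous.
by apply/funext => x; rewrite partial_cst.
Qed.

Lemma C1D k (f h : 'rV[R]_k -> R) : C1 f -> C1 h -> C1 (fun x => f x + h x).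
Proof.
move=> [df cf] [dh ch]; split=> [x|i]; first exact: differentiableD.
rewrite [partial i _](_ : _ = partial i f + partial i h).
  by move=> x; apply: continuousD; [exact: cf|exact: ch].
by apply/funext => x; rewrite partialD.
Qed.

Lemma C1M k (f h : 'rV[R]_k -> R) : C1 f -> C1 h -> C1 (fun x => f x * h x).
Proof.
move=> [df cf] [dh ch]; split=> [x|i]; first exact: differentiableM.
rewrite [partial i _](_ : _ = f * partial i h + h * partial i f).
  move=> x; have fx := differentiable_continuous (df x).
  have hx := differentiable_continuous (dh x).
  exact: (continuousD (continuousM fx (ch i x)) (continuousM hx (cf i x))).
by apply/funext => x; rewrite partialM.
Qed.

Lemma C1Z k a (f : 'rV[R]_k -> R) : C1 f -> C1 (fun x => a * f x).
Proof. exact/C1M/C1_cst. Qed.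

Lemma C1_sum k l (f : 'I_l -> 'rV[R]_k -> R) :
  (forall j, C1 (f j)) -> C1 (fun x => \sum_j f j x).
Proof.
move=> Cf; rewrite [X in C1 X](_ : _ = \sum_j f j); last first.
  by apply/funext => x; rewrite fct_sumE.
elim/big_ind: _ => [|a b Ca Cb|j _]; first exact: (C1_cst k 0).
- exact: (C1D Ca Cb).
- exact: Cf.
Qed.

Lemma C1_coord k (j : 'I_k) : C1 (fun x : 'rV[R]_k => x 0 j).
Proof.
split=> [x|i]; first exact: differentiable_coord.
rewrite [partial i _](_ : _ = cst (i == j)%:R); first by apply: cst_continuous.
by apply/funext => x; rewrite partial_coord.
Qed.

Lemma C1_mulmxr k l (P : 'M[R]_(k, l)) (h : 'rV[R]_l -> R) :
  C1 h -> C1 (fun s => h (s *m P)).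
Proof.
move=> [dh ch]; have dP := differentiable_mulmxr P.
split=> [s|i]; first exact: differentiable_comp.
rewrite [partial i _](_ : _ =
    \sum_j (cst (P i j) * (fun s => partial j h (s *m P)))); last first.
  by apply/funext => s; rewrite partial_mulmxr// fct_sumE.
elim/big_ind: _ => // [|a b ca cb s|j _ s]; first exact: cst_continuous.
- by apply: continuousD; [exact: ca|exact: cb].
- have cP := differentiable_continuous (dP s).
  exact: (continuousM (@cst_continuous _ _ _ _) (continuous_comp cP (ch j _))).
Qed.

Lemma C2D k (f h : 'rV[R]_k -> R) : C2 f -> C2 h -> C2 (fun x => f x + h x).
Proof.
move=> [Cf Cf'] [Ch Ch']; split=> [|i]; first exact: C1D.
rewrite [partial i _](_ : _ = (fun x => partial i f x + partial i h x)).
  exact: (C1D (Cf' i) (Ch' i)).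
by apply/funext => x; rewrite partialD//; [exact: Cf.1|exact: Ch.1].
Qed.

Lemma C2Z k a (f : 'rV[R]_k -> R) : C2 f -> C2 (fun x => a * f x).
Proof.
move=> [Cf Cf']; split=> [|i]; first exact: C1Z.
rewrite [partial i _](_ : _ = (fun x => a * partial i f x)); first exact: C1Z.
by apply/funext => x; rewrite partialZ//; exact: Cf.1.
Qed.

Lemma C2_cst k a : C2 (fun=> a : R) (k := k).
Proof.
split=> [|i]; first exact: C1_cst.
rewrite [partial i _](_ : _ = (fun=> 0)); first exact: C1_cst.
by apply/funext => x; rewrite partial_cst.
Qed.

Lemma C2_sum k l (f : 'I_l -> 'rV[R]_k -> R) :
  (forall j, C2 (f j)) -> C2 (fun x => \sum_j f j x).
Proof.
move=> Cf; rewrite [X in C2 X](_ : _ = \sum_j f j); last first.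
  by apply/funext => x; rewrite fct_sumE.
elim/big_ind: _ => [|a b Ca Cb|j _]; first exact: (C2_cst k 0).
- exact: (C2D Ca Cb).
- exact: Cf.
Qed.

Lemma C2_mulmxr k l (P : 'M[R]_(k, l)) (h : 'rV[R]_l -> R) :
  C2 h -> C2 (fun s => h (s *m P)).
Proof.
move=> [Ch Ch']; split=> [|i]; first exact: C1_mulmxr.
rewrite [partial i _](_ : _ = (fun s => \sum_j P i j * partial j h (s *m P))).
  by apply: C1_sum => j; apply: C1Z; exact: (C1_mulmxr P (Ch' j)).
by apply/funext => s; rewrite partial_mulmxr//; exact: Ch.1.
Qed.

Lemma hessD k (f h : 'rV[R]_k -> R) x :
  C2 f -> C2 h -> hess (fun x => f x + h x) x = hess f x + hess h x.
Proof.
move=> [Cf Cf'] [Ch Ch']; apply/matrixP => i j.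
transitivity (partial i (fun y => partial j f y + partial j h y) x).
  rewrite mxE; congr (partial i _ x); apply/funext => y.
  by rewrite partialD//; [exact: Cf.1|exact: Ch.1].
rewrite [RHS]mxE; apply: etrans (partialD i ((Cf' j).1 x) ((Ch' j).1 x)) _.
by apply: congr2; rewrite mxE.
Qed.

Lemma hessZ k a (f : 'rV[R]_k -> R) x :
  C2 f -> hess (fun x => a * f x) x = a *: hess f x.
Proof.
move=> [Cf Cf']; apply/matrixP => i j.
transitivity (partial i (fun y => a * partial j f y) x).
  rewrite mxE; congr (partial i _ x); apply/funext => y.
  by rewrite partialZ//; exact: Cf.1.
rewrite [RHS]mxE; apply: etrans (partialZ i a ((Cf' j).1 x)) _.
by rewrite !mxE.
Qed.

Lemma hess_mulmxr k l (P : 'M[R]_(k, l)) (h : 'rV[R]_l -> R) s :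
  C2 h -> hess (fun s => h (s *m P)) s = P *m hess h (s *m P) *m P^T.
Proof.
move=> [Ch Ch']; apply/matrixP => i j; rewrite !mxE.
transitivity (partial i (fun s => \sum_b P j b * partial b h (s *m P)) s).
  by congr (partial i _ s); apply/funext => y; rewrite partial_mulmxr//; exact: Ch.1.
rewrite partial_sum; last first.
  by move=> b; exact: (C1Z _ (C1_mulmxr P (Ch' b))).1.
apply: eq_bigr => b _; rewrite partialZ; last exact: (C1_mulmxr P (Ch' b)).1.
rewrite (@partial_mulmxr _ _ _ (partial b h)); last exact: (Ch' b).1.
rewrite !mxE mulrC; congr (_ * _); apply: eq_bigr => a _.
by rewrite !mxE.
Qed.

(** * Mean values and symmetry of second derivatives *)

Lemma MVT_line k (h : 'rV[R]_k -> R) x e (t : R) : 0 < t ->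
  (forall x, differentiable h x) ->
  exists2 c, 0 < c < t & h (x + t *: e) - h x = t * 'D_e h (x + c *: e).
Proof.
move=> t0 dh.
have dl (r : R) :
    is_derive r (1 : R) (fun t : R => h (x + t *: e)) ('D_e h (x + r *: e)).
  apply: DeriveDef; last exact: derive_line.
  by apply: derivable_line; exact: diff_derivable.
have [|c ct] := MVT t0 (fun r _ => dl r).
- apply: derivable_within_continuous => r _; exact: ex_derive.
- rewrite scale0r addr0 subr0 mulrC => ->; exists c => //.
Qed.

(** The mean value theorem is applied twice: to the increment [h (s + t *: b) - h s] along direction
    [i], then to [partial i h] along direction [j]. *)
Lemma second_difference k (h : 'rV[R]_k -> R) x i j (t : R) : 0 < t -> C2 h ->
  exists c1 c2, [/\ 0 < c1 < t, 0 < c2 < t &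
    h (x + t *: delta_mx 0 i + t *: delta_mx 0 j) - h (x + t *: delta_mx 0 i)
      - h (x + t *: delta_mx 0 j) + h x
    = t * (t * partial j (partial i h)
               (x + c1 *: delta_mx 0 i + c2 *: delta_mx 0 j))].
Proof.
move=> t0 [Ch Ch'].
set a := delta_mx 0 i; set b := delta_mx 0 j.
pose f s := h (s + t *: b) - h s.
have dT s : differentiable (fun s => h (s + t *: b)) s.
  apply: (@differentiable_comp _ _ _ _ (fun s => s + t *: b)).
    exact: differentiableD.
  exact: Ch.1.
have df s : differentiable f s by apply: differentiableB => //; exact: Ch.1.
have [c1 c1t E] := MVT_line x a t0 df.
have [c2 c2t E2] := MVT_line (x + c1 *: a) b t0 (Ch' i).1.
exists c1, c2; split=> //.
have Eb : 'D_a (fun s => h (s + t *: b)) (x + c1 *: a) =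
    partial i h (x + c1 *: a + t *: b).
  by apply: eq_derive => r; rewrite -addrA.
rewrite -E2 -Eb.
transitivity (t * 'D_a f (x + c1 *: a)); first by rewrite -E /f; ring.
congr (t * _); apply: deriveB; apply: diff_derivable; first exact: dT.
exact: Ch.1.
Qed.

(** The second difference is symmetric in [i] and [j], so the two mixed derivatives agree at
    suitable points arbitrarily close to [x]; continuity carries the equality to [x]. *)
Lemma partialC k (h : 'rV[R]_k -> R) x i j : C2 h ->
  partial i (partial j h) x = partial j (partial i h) x.
Proof.
move=> Ch; apply/eqP; rewrite -subr_eq0 -normr_le0.
apply/ler_addgt0Pl => e e0; rewrite addr0.
have e20 : 0 < e / 2 by rewrite divr_gt0.
have := (Ch.2 j).2 i x => /cvgrPdist_lt/(_ _ e20)/nbhs_normP[d1 d10 H1].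
have := (Ch.2 i).2 j x => /cvgrPdist_lt/(_ _ e20)/nbhs_normP[d2 d20 H2].
set a := delta_mx 0 i : 'rV[R]_k; set b := delta_mx 0 j : 'rV[R]_k.
(* With this step both intermediate points stay within [d1] and [d2] of [x]; the summand 1 keeps the
   denominator positive and the estimate strict. *)
pose t := Num.min d1 d2 / (`|a| + `|b| + 1).
have N0 : 0 < `|a| + `|b| + 1 by rewrite ltr_wpDl// addr_ge0.
have t0 : 0 < t by rewrite divr_gt0// lt_min d10.
have near_x c c' : 0 < c < t -> 0 < c' < t ->
    `|x - (x + c *: a + c' *: b)| < Num.min d1 d2.
  move=> /andP[c0 ct] /andP[c'0 c't].
  rewrite -addrA opprD addrA subrr sub0r normrN.
  apply: le_lt_trans (ler_normD _ _) _; rewrite !normrZ !gtr0_norm//.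
  have -> : Num.min d1 d2 = t * (`|a| + `|b| + 1) by rewrite divfK// gt_eqF.
  by rewrite -[ltLHS]addr0 !mulrDr mulr1 ler_ltD// lerD// ler_wpM2r// ltW.
have [c1 [c2 [c1t c2t E1]]] := second_difference x i j t0 Ch.
have [c3 [c4 [c3t c4t E2]]] := second_difference x j i t0 Ch.
have E : partial j (partial i h) (x + c1 *: a + c2 *: b)
       = partial i (partial j h) (x + c3 *: b + c4 *: a).
  have tn0 : t != 0 by rewrite gt_eqF.
  apply: (mulfI tn0); apply: (mulfI tn0).
  apply: etrans (esym E1) _; apply: etrans _ E2.
  by rewrite [x + t *: b + _]addrAC; ring.
have := near_x _ _ c1t c2t; rewrite lt_min => /andP[_ /H2].
have := near_x _ _ c4t c3t; rewrite addrAC lt_min => /andP[/H1 /= + _].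
rewrite /= E.
set u := partial i (partial j h) x; set v := partial j (partial i h) x.
set w := partial i _ _; move: u v w => u v w uw vw.
rewrite -(subrK w u) -addrA; apply: le_trans (ler_normD _ _) _.
rewrite [leRHS]splitr; apply: lerD; apply: ltW; first exact: uw.
by rewrite distrC.
Qed.

Lemma hess_sym k (h : 'rV[R]_k -> R) x : C2 h -> (hess h x)^T = hess h x.
Proof. by move=> Ch; apply/matrixP => i j; rewrite !mxE partialC. Qed.

End Partial.

(** * Limits of gradients of one Fischer-Burmeister component *)

Section FischerBurmeister.
Context {R : realType}.

Lemma not_derivable_norm0 : ~ derivable (fun t : R => `|t|) 0 1.
Proof.
rewrite /derivable => /cvg_ex[l] /cvgrPdist_lt/(_ 1 ltr01).
move=> /nbhs_ballP[e /= e0 He].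
have e2 : 0 < e / 2 by rewrite divr_gt0.
have e2e : e / 2 < e by rewrite gtr_pMr// invf_lt1// ltr1n.
have Hl t : `|t| < e -> t != 0 -> `|l - t^-1 * `|t| | < 1.
  move=> te t0; have := He t; rewrite /ball /= sub0r normrN => /(_ te t0).
  by rewrite addr0 scaler1 normr0 subr0.
have e2n0 : e / 2 != 0 by rewrite gt_eqF.
(* The quotient is 1 at [e / 2] and -1 at [- (e / 2)], and no [l] is strictly within 1 of both. *)
have := Hl (e / 2); have := Hl (- (e / 2)).
rewrite oppr_eq0 normrN gtr0_norm// => /(_ e2e e2n0) + /(_ e2e e2n0).
rewrite invrN mulNr mulVf//.
by rewrite !ltr_norml; lra.
Qed.

Context {k : nat} (i : 'I_k) (h : 'rV[R]_k -> R).
(** Here [s] will be the vector of all variables and multipliers, [h] one constraint, and coordinate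
    [i] the multiplier of that constraint. *)
Hypothesis h_indep : forall s t, h (s + t *: delta_mx 0 i) = h s.
Let psi (s : 'rV[R]_k) := fischer_burmeister (- h s) (s 0 i).
Let rho (s : 'rV[R]_k) := Num.sqrt ((- h s) ^+ 2 + s 0 i ^+ 2).

(** If [h s] and [s 0 i] both vanished, then [h] would stay zero along coordinate [i] and [psi]
    would be [|t| - t] there, which has a kink at 0. *)
Lemma differentiable_fb_radius_gt0 s : differentiable psi s -> 0 < rho s.
Proof.
move=> dpsi; rewrite lt_neqAle sqrtr_ge0 andbT eq_sym sqrtr_eq0 -ltNge.
rewrite lt_neqAle addr_ge0 ?sqr_ge0// andbT eq_sym paddr_eq0 ?sqr_ge0//.
rewrite !sqrf_eq0 oppr_eq0; apply/negP => /andP[/eqP hs0 /eqP si0].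
apply: not_derivable_norm0.
have : derivable (fun t : R => psi (s + t *: delta_mx 0 i)) 0 1.
  by apply: derivable_line; rewrite scale0r addr0; exact: diff_derivable.
have did : derivable (@id R) 0 (1 : R) by exact: derivable_id.
move=> /derivableD/(_ did).
rewrite (_ : _ + id = (fun t => `|t|))//; apply/funext => t.
transitivity (psi (s + t *: delta_mx 0 i) + t) => //.
rewrite /psi /fischer_burmeister h_indep hs0.
rewrite !mxE si0 !eqxx mulr1 add0r !oppr0 expr0n /= add0r addr0.
rewrite subrK.
by rewrite sqrtr_sqr.
Qed.

Lemma partial_fb s j : differentiable h s -> differentiable psi s ->
  partial j psi s = - (- h s / rho s - 1) * partial j h s
    + (s 0 i / rho s - 1) * (j == i)%:R.
Proof.
move=> dh dpsi; have r0 := differentiable_fb_radius_gt0 dpsi.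
have dc : differentiable (fun s : 'rV[R]_k => s 0 i) s.
  exact: differentiable_coord.
have rhoE : rho = fun s => psi s + (- 1 * h s + s 0 i).
  by apply/funext => y; rewrite /rho /psi /fischer_burmeister; ring.
have dNh : differentiable (fun s => -1 * h s) s by exact: differentiableZ.
have dr : differentiable rho s.
  rewrite rhoE; apply: differentiableD => //; exact: differentiableD.
have prho : partial j rho s = partial j psi s - partial j h s + (j == i)%:R.
  rewrite rhoE; apply: etrans (partialD j dpsi (differentiableD dNh dc)) _.
  rewrite -addrA; congr (_ + _).
  apply: etrans (partialD j dNh dc) _; congr (_ + _); last exact: partial_coord.
  by apply: etrans (partialZ j _ dh) _; rewrite mulN1r.
(* Differentiating [rho ^ 2] instead of [rho] avoids the derivative of the
   square root, since [rho = psi - h + s_i] is known to be differentiable. *)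
have sq : (fun s => rho s * rho s) = (fun s => h s * h s + s 0 i * s 0 i).
  apply/funext => y; rewrite -expr2 sqr_sqrtr ?addr_ge0 ?sqr_ge0//.
  by rewrite sqrrN !expr2.
have psq : 2 * rho s * partial j rho s =
    2 * h s * partial j h s + 2 * s 0 i * (j == i)%:R.
  have := congr1 (fun f => partial j f s) sq.
  rewrite (partialM j dr dr).
  rewrite (partialD j (differentiableM dh dh) (differentiableM dc dc)).
  rewrite (partialM j dh dh) (partialM j dc dc) partial_coord.
  by move: (partial j rho s) (partial j h s) => a b; lra.
have -> : partial j psi s = partial j rho s + partial j h s - (j == i)%:R.
  by rewrite prho; ring.
have -> : partial j rho s =
    (h s * partial j h s + s 0 i * (j == i)%:R) / rho s.
  apply: (@mulfI _ (2 * rho s)); first by rewrite gt_eqF// mulr_gt0.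
  rewrite psq; move: (partial j h s) (h s) (s 0 i) (rho s) r0 => ? ? ? r r0.
  by field; rewrite gt_eqF.
move: (partial j h s) (h s) (s 0 i) (rho s) r0 => ? ? ? r r0.
by field; rewrite gt_eqF.
Qed.

Lemma partial_indep s : partial i h s = 0.
Proof.
rewrite /partial -(derive_cst (h s) s (delta_mx 0 i)).
by apply: eq_derive => t; rewrite addrC h_indep.
Qed.

Lemma fb_radius_disc s : 0 < rho s ->
  (- h s / rho s) ^+ 2 + (s 0 i / rho s) ^+ 2 = 1.
Proof.
move=> r0; rewrite !expr_div_n -mulrDl -[X in _ / X]/(rho s ^+ 2).
rewrite [in X in _ / X]sqr_sqrtr ?addr_ge0 ?sqr_ge0// divff//.
by move: r0; rewrite sqrtr_gt0 => /gt_eqF ->.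
Qed.

(* With [a = al + 1] and [b = be + 1] the pair [(a, b)] is on the unit circle,
   hence [a + b <= sqrt 2 <= 3 / 2]; the bound keeps the pairs away from
   [(0, 0)] also after convexification. *)
Lemma limiting_fb (s_ : nat -> 'rV[R]_k) s (r : 'I_k -> R) : C1 h ->
  s_ t @[t --> \oo] --> s -> (forall t, differentiable psi (s_ t)) ->
  (forall j, partial j psi (s_ t) @[t --> \oo] --> r j) ->
  h s <= 0 -> 0 <= s 0 i -> h s * s 0 i = 0 ->
  (h s = 0 -> exists j, partial j h s != 0) ->
  exists al be, [/\ al <= 0, be <= 0, al + be <= - (1 / 2),
    (h s != 0 -> al = 0) /\ (0 < s 0 i -> be = 0) &
    forall j, r j = - al * partial j h s + be * (j == i)%:R].
Proof.
move=> [dh ch] s_s dpsi psir hs si hsi hs0.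
pose a t := - h (s_ t) / rho (s_ t) - 1.
pose b t := s_ t 0 i / rho (s_ t) - 1.
have psiE j t :
    partial j psi (s_ t) = - a t * partial j h (s_ t) + b t * (j == i)%:R.
  exact: partial_fb.
have chs : h (s_ t) @[t --> \oo] --> h s.
  exact: (cvg_comp _ _ s_s (differentiable_continuous (dh s))).
have cps j : partial j h (s_ t) @[t --> \oo] --> partial j h s.
  exact: (cvg_comp _ _ s_s (ch j s)).
have cis : s_ t 0 i @[t --> \oo] --> s 0 i.
  exact: (cvg_comp _ _ s_s (@coord_continuous R 1 k 0 i s)).
have crho : rho (s_ t) @[t --> \oo] --> rho s.
  have cq : (- h (s_ t)) * (- h (s_ t)) + s_ t 0 i * s_ t 0 i @[t --> \oo] -->
      (- h s) * (- h s) + s 0 i * s 0 i.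
    by apply: cvgD; apply: cvgM => //; exact: cvgN.
  exact: (cvg_comp _ _ cq (@sqrt_continuous R _)).
(* Once the coefficients converge, the circle relation and the gradient formula pass to the limit,
   and the sign bounds follow from the circle. *)
suff [al [be [aal bbe st ac]]] : exists al be, [/\ a t @[t --> \oo] --> al,
    b t @[t --> \oo] --> be, 0 < s 0 i -> be = 0 & h s != 0 -> al = 0].
  have disc : (al + 1) ^+ 2 + (be + 1) ^+ 2 = 1.
    have : (a t + 1) * (a t + 1) + (b t + 1) * (b t + 1) @[t --> \oo] -->
        (al + 1) * (al + 1) + (be + 1) * (be + 1).
      apply: cvgD; apply: cvgM; apply: cvgD => //; exact: cvg_cst.
    have -> : (fun t => (a t + 1) * (a t + 1) + (b t + 1) * (b t + 1)) = cst 1.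
      apply/funext => t; rewrite /a /b !subrK -!expr2 fb_radius_disc//.
      exact: differentiable_fb_radius_gt0.
    by move=> /cvg_lim <- //; rewrite lim_cst.
  have al0 : al <= 0.
    by have := sqr_ge0 (be + 1); rewrite leNgt => ?; apply/negP => ?; nra.
  have be0 : be <= 0.
    by have := sqr_ge0 (al + 1); rewrite leNgt => ?; apply/negP => ?; nra.
  have abl : al + be <= - (1 / 2).
    by have := sqr_ge0 (al - be); rewrite leNgt => ?; apply/negP => ?; nra.
  exists al, be; split=> // j.
  have /cvg_lim <- // := psir j; apply/cvg_lim => //.
  rewrite (_ : (fun t => _) =
    (fun t => - a t * partial j h (s_ t) + b t * (j == i)%:R)).
    exact: (cvgD (cvgM (cvgN aal) (cps j)) (cvgM bbe (cvg_cst _))).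
  by apply/funext => t; exact: psiE.
(* Where [rho s] is nonzero both quotients converge to their values at [s]. This settles the cases
   [h s < 0] and [0 < s 0 i]; by complementarity only the case where both vanish remains. *)
have reg : rho s != 0 -> a t @[t --> \oo] --> - h s / rho s - 1 /\
    b t @[t --> \oo] --> s 0 i / rho s - 1.
  move=> r0; split; apply: cvgB; do ?[exact: cvg_cst]; apply: cvgM.
  - exact: cvgN.
  - exact: cvgV.
  - exact: cis.
  - exact: cvgV.
have [hse0|hsn0] := eqVneq (h s) 0; last first.
  have si0 : s 0 i = 0 by move/eqP: hsi; rewrite mulf_eq0 (negPf hsn0) => /eqP.
  have hlt : h s < 0 by rewrite lt_neqAle hsn0.
  have rE : rho s = - h s.
    by rewrite /rho si0 expr0n /= addr0 sqrtr_sqr gtr0_norm// oppr_gt0.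
  have rn0 : rho s != 0 by rewrite rE oppr_eq0.
  have [ca cb] := reg rn0; exists (- h s / rho s - 1), (s 0 i / rho s - 1).
  split=> //; first by rewrite si0 ltxx.
  by move=> _; rewrite rE divff ?subrr// oppr_eq0.
have [sie0|sin0] := eqVneq (s 0 i) 0; last first.
  have slt : 0 < s 0 i by rewrite lt_neqAle eq_sym sin0.
  have rE : rho s = s 0 i.
    by rewrite /rho hse0 oppr0 expr0n /= add0r sqrtr_sqr gtr0_norm.
  have rn0 : rho s != 0 by rewrite rE.
  have [ca cb] := reg rn0; exists (- h s / rho s - 1), (s 0 i / rho s - 1).
  split=> //.
  by rewrite rE divff ?subrr.
(* Biactive case: the ratio with a nonzero partial derivative determines the
   limit of [a]. *)
have [j hj] := hs0 hse0.
have ji : (j == i) = false.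
  by apply/negbTE; apply: contra hj => /eqP ->; rewrite partial_indep.
exists (- (r j / partial j h s)), (r i); rewrite sie0 ltxx; split=> //.
- apply: (@cvg_trans _ (- (partial j psi (s_ t) / partial j h (s_ t)) @[t --> \oo])).
    apply: near_eq_cvg; near=> t.
    rewrite psiE ji mulr0 addr0 mulfK ?opprK//.
    near: t; exact: (cvgr_neq0 _ (cps j)).
  by apply: cvgN; apply: cvgM => //; exact: cvgV.
(* In direction [i] the derivative of [h] vanishes, so [b] is itself a partial derivative of [psi]
   and inherits the limit [r i]. *)
- rewrite (_ : b = fun t => partial i psi (s_ t)); first exact: psir.
  by apply/funext => t; rewrite psiE partial_indep mulr0 add0r eqxx mulr1.
Unshelve. all: by end_near. Qed.

End FischerBurmeister.

(** * Nonsingularity of saddle-point block matrices *)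

Lemma unitmx_inj (K : fieldType) k (M : 'M[K]_k) :
  (forall v : 'rV_k, v *m M = 0 -> v = 0) -> M \in unitmx.
Proof.
move=> M_inj; rewrite -row_free_unit -kermx_eq0; apply/rowV0P => v.
by move/sub_kermxP; exact: M_inj.
Qed.

(** Multiplying the test direction by [D] turns the weights [sg], possibly negative, into the
    positive weights [tau]. The first block row tested with [d *m D] is then a sum of the quadratic
    form and nonnegative terms, which forces [d = 0]; independence then gives [e = 0]. *)
Lemma saddle_unitmx (K : realFieldType) k l (H D : 'M[K]_k) (J : 'M[K]_(l, k))
    (sg tau al be : 'rV[K]_l) :
  (forall j, [/\ 0 < tau 0 j, al 0 j <= 0, be 0 j <= 0 & al 0 j + be 0 j < 0]) ->
  D *m J^T *m diag_mx sg = J^T *m diag_mx tau ->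
  (forall d : 'rV_k, (forall j, be 0 j = 0 -> (d *m J^T) 0 j = 0) -> d != 0 ->
    0 < (d *m D *m H *m d^T) 0 0) ->
  (forall e : 'rV_l, (forall j, al 0 j = 0 -> e 0 j = 0) ->
    e *m diag_mx sg *m J = 0 -> e = 0) ->
  block_mx H (J^T *m diag_mx sg) (- diag_mx al *m J) (diag_mx be) \in unitmx.
Proof.
(* The transpose is tested because vectors are rows: [v] in its left kernel means that the original
   matrix kills the column [v^T]. *)
move=> sgn DJ Hpos licq; rewrite -unitmx_tr; apply: unitmx_inj => v.
rewrite -[v]hsubmxK; set d := lsubmx v; set e := rsubmx v.
rewrite tr_block_mx mul_row_block -row_mx0 => /eq_row_mx[].
rewrite !trmx_mul !trmxK !mulmxA linearN /= !tr_diag_mx mulmxN => top bot.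
have botE j : al 0 j * (d *m J^T) 0 j = e 0 j * be 0 j.
  move: (d *m J^T) bot => r.
  rewrite !mul_mx_diag => /rowP/(_ j); rewrite !mxE => /eqP.
  by rewrite addrC subr_eq0 => /eqP ->; rewrite mulrC.
(* If [al 0 j = 0] then [be 0 j < 0] and [botE] gives [e 0 j = 0]. Otherwise, multiplying [botE] by
   [e 0 j] shows that [al 0 j] times the product is [be 0 j * e 0 j ^+ 2 <= 0], and [al 0 j < 0]. *)
have tp j : 0 <= e 0 j * (d *m J^T) 0 j.
  have [_ a0 b0 ab] := sgn j; move: (botE j).
  move: (al 0 j) (be 0 j) (e 0 j) ((d *m J^T) 0 j) a0 b0 ab => a b u c a0 b0 ab E.
  have [a00|an0] := eqVneq a 0.
    have b0' : b < 0 by rewrite a00 add0r in ab.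
    move/eqP: E; rewrite a00 mul0r eq_sym mulf_eq0 => /orP[/eqP ->|/eqP bE].
      by rewrite mul0r.
    by rewrite bE ltxx in b0'.
  have a0' : a < 0 by rewrite lt_neqAle an0.
  rewrite -(nmulr_rle0 _ a0') mulrCA E mulrA mulrC -expr2.
  by rewrite mulr_le0_ge0 ?sqr_ge0.
have d0 : d = 0.
  apply/eqP/negPn/negP => dn0.
  have dQ j : be 0 j = 0 -> (d *m J^T) 0 j = 0.
    move=> bj; have := botE j; rewrite bj mulr0 => /eqP; rewrite mulf_eq0.
    have [_ _ _ ] := sgn j; rewrite bj addr0 => /lt_eqF ->.
    by move=> /eqP.
  have := Hpos d dQ dn0.
  have /(congr1 (fun r => (r *m (d *m D)^T) 0 0)) := top.
  rewrite mulmxDl mul0mx mxE [RHS]mxE.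
  have -> : (d *m H^T *m (d *m D)^T) 0 0 = (d *m D *m H *m d^T) 0 0.
    rewrite -[in RHS](trmxK (d *m D *m H *m d^T)) [RHS]mxE.
    by rewrite !trmx_mul trmxK !mulmxA.
  have -> : e *m diag_mx sg *m J *m (d *m D)^T = e *m (d *m (J^T *m diag_mx tau))^T.
    by rewrite -DJ !trmx_mul !trmxK tr_diag_mx !mulmxA.
  have : 0 <= (e *m (d *m (J^T *m diag_mx tau))^T) 0 0.
    rewrite mxE; apply: sumr_ge0 => j _.
    rewrite [X in _ * X]mxE mulmxA mul_mx_diag [X in _ * X]mxE mulrA mulr_ge0//.
    by have [/ltW] := sgn j.
  by move=> ge0 E gt0; move: (ltr_pwDl gt0 ge0); rewrite E ltxx.
(* With [d = 0] the second block row reads [e 0 j * be 0 j = 0]; where [al 0 j = 0] the entry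
   [be 0 j] is negative, so [e] has the support required by [licq]. *)
move: top bot; rewrite d0 !mul0mx oppr0 !add0r => top bot.
have -> : e = 0.
  apply: licq => // j aj; have [_ _ _] := sgn j; rewrite aj add0r => bj.
  have := botE j; rewrite aj mul0r => /esym/eqP; rewrite mulf_eq0 (lt_eqF bj) orbF.
  by move=> /eqP.
by rewrite row_mx0.
Qed.

(** * Entries of the Jacobian as partial derivatives *)

Section Jacobian.
Context {R : realType}.

Lemma differentiable_component k l (h : 'rV[R]_k -> 'rV[R]_l) s a :
  differentiable h s -> differentiable (fun x => h x 0 a) s.
Proof.
move=> dh; exact: (differentiable_comp dh (differentiable_coord (h s) 0 a)).
Qed.

Lemma jacE k l (h : 'rV[R]_k -> 'rV[R]_l) s a b :
  differentiable h s -> jac h s a b = partial b (fun x => h x 0 a) s.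
Proof.
move=> dh; have dv : derivable h s (delta_mx 0 b) by exact: diff_derivable.
transitivity (('D_(delta_mx 0 b) h s) 0 a); last by rewrite derive_mx// mxE.
by rewrite deriveEjacobian// -rowE !mxE.
Qed.

End Jacobian.

(** * Clarke Jacobian of an abstract Karush-Kuhn-Tucker system with weighted multipliers *)

Section FBSystem.
Context {R : realType} {k l : nat}.
Context (A : 'rV[R]_k -> R) (c : 'rV[R]_k -> 'rV[R]_l) (sg : 'rV[R]_l).
Hypotheses (A_C2 : C2 A) (c_C2 : C2_vec c).

Definition weighted_lagrangian (mu : 'rV[R]_l) (s : 'rV[R]_k) : R :=
  A s + \sum_j sg 0 j * mu 0 j * c s 0 j.
Local Notation wlag := weighted_lagrangian.

Definition fb_system (zeta : 'rV[R]_(k + l)) : 'rV[R]_(k + l) :=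
  row_mx (grad (wlag (rsubmx zeta)) (lsubmx zeta))
         (fb_vec (c (lsubmx zeta)) (rsubmx zeta)).

Definition constraint_jacobian (s : 'rV[R]_k) : 'M[R]_(l, k) :=
  \matrix_(j, i) partial i (fun s => c s 0 j) s.

Lemma C2_weighted_lagrangian mu : C2 (wlag mu).
Proof.
exact: (C2D A_C2 (C2_sum (fun j => C2Z (sg 0 j * mu 0 j) (c_C2 j)))).
Qed.

Lemma partial_weighted_lagrangian i mu s :
  partial i (wlag mu) s =
  partial i A s + \sum_j sg 0 j * mu 0 j * partial i (fun s => c s 0 j) s.
Proof.
have dc j : differentiable (fun s => c s 0 j) s by exact: (c_C2 j).1.1.
have dt j : differentiable (fun s => sg 0 j * mu 0 j * c s 0 j) s.
  exact: differentiableZ.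
apply: etrans (partialD i (A_C2.1.1 s) _) _.
  rewrite (_ : (fun s => _) = \sum_j (fun s => sg 0 j * mu 0 j * c s 0 j)).
    exact: differentiable_sum.
  by apply/funext => y; rewrite fct_sumE.
congr (_ + _); apply: etrans (partial_sum i dt) _.
by apply: eq_bigr => j _; exact: partialZ.
Qed.

(** The gradient is affine in the multipliers with coefficients that are C1 in the variables. Hence
    the first block row of a limiting Jacobian is simply the derivative at the limit point. *)
Lemma C1_grad_weighted_lagrangian i :
  C1 (fun zeta : 'rV[R]_(k + l) => partial i (wlag (rsubmx zeta)) (lsubmx zeta)).
Proof.
pose L : 'M[R]_(k + l, k) := col_mx 1%:M 0.
have LE (zeta : 'rV[R]_(k + l)) : lsubmx zeta = zeta *m L.
  by rewrite -[in RHS](hsubmxK zeta) mul_row_col mulmx1 mulmx0 addr0.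
rewrite (_ : (fun zeta => _) = (fun zeta => partial i A (zeta *m L) +
    \sum_j sg 0 j * zeta 0 (rshift k j) *
      partial i (fun s => c s 0 j) (zeta *m L))); last first.
  apply/funext => zeta; rewrite partial_weighted_lagrangian LE.
  by congr (_ + _); apply: eq_bigr => j _; rewrite mxE.
apply: (C1D (C1_mulmxr L (A_C2.2 i))).
apply: (@C1_sum _ _ _ (fun j (zeta : 'rV[R]_(k + l)) =>
  sg 0 j * zeta 0 (rshift k j) * partial i (fun s => c s 0 j) (zeta *m L))) => j.
exact: (C1M (C1Z (sg 0 j) (C1_coord (rshift k j)))
            (C1_mulmxr L ((c_C2 j).2 i))).
Qed.

(** The unit circle relation does not survive convex combinations; only conditions convex in
    [(al, be)] are kept. *)
Definition fb_coefficients (s : 'rV[R]_k) (mu al be : 'rV[R]_l) : Prop :=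
  forall j, [/\ al 0 j <= 0, be 0 j <= 0, al 0 j + be 0 j <= - (1 / 2) &
    (c s 0 j != 0 -> al 0 j = 0) /\ (0 < mu 0 j -> be 0 j = 0)].

Definition fb_jacobian (s : 'rV[R]_k) (mu al be : 'rV[R]_l) : 'M[R]_(k + l) :=
  block_mx (hess (wlag mu) s) ((constraint_jacobian s)^T *m diag_mx sg)
           (- diag_mx al *m constraint_jacobian s) (diag_mx be).

(** The rows are treated one at a time: gradient rows by continuity of their derivatives,
    complementarity rows by [limiting_fb], whose biactive case is where nonvanishing active
    gradients enter. *)
Lemma limiting_jacobians_fb_system s (mu : 'rV[R]_l) (M : 'M[R]_(k + l)) :
  (forall j, [/\ 0 <= mu 0 j, c s 0 j <= 0 & c s 0 j * mu 0 j = 0]) ->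
  (forall j, c s 0 j = 0 -> exists i, partial i (fun s => c s 0 j) s != 0) ->
  limiting_jacobians fb_system (row_mx s mu) M ->
  exists al be, fb_coefficients s mu al be /\ M = fb_jacobian s mu al be.
Proof.
move=> compl active_grad [z_ [z_cvg dPhi JM]].
have comp_cvg a b :
    partial b (fun x => fb_system x 0 a) (z_ t) @[t --> \oo] --> M a b.
  rewrite (_ : (fun t => _) = (fun t => jac fb_system (z_ t) a b)).
    exact: (cvg_comp _ _ JM (@coord_continuous R _ _ a b M)).
  by apply/funext => t; rewrite jacE.
have Mtop i b : M (lshift l i) b =
    partial b (fun zeta : 'rV[R]_(k + l) =>
      partial i (wlag (rsubmx zeta)) (lsubmx zeta)) (row_mx s mu).
  have := cvg_comp _ _ z_cvg
    ((C1_grad_weighted_lagrangian i).2 b (row_mx s mu)).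
  move=> /cvg_lim <- //; apply/esym/cvg_lim => //.
  have := comp_cvg (lshift l i) b.
  rewrite (_ : (fun x => fb_system x 0 (lshift l i)) = (fun zeta =>
    partial i (wlag (rsubmx zeta)) (lsubmx zeta)))//.
  by apply/funext => zeta; rewrite row_mxEl mxE.
pose h j (zeta : 'rV[R]_(k + l)) := c (lsubmx zeta) 0 j.
have h_C1 j : C1 (h j).
  pose L : 'M[R]_(k + l, k) := col_mx 1%:M 0.
  have -> : h j = fun zeta => c (zeta *m L) 0 j.
    apply/funext => zeta; congr (c _ 0 j).
    by rewrite -[in RHS](hsubmxK zeta) mul_row_col mulmx1 mulmx0 addr0.
  exact: (C1_mulmxr L (c_C2 j).1).
have h_indep j zeta t : h j (zeta + t *: delta_mx 0 (rshift k j)) = h j zeta.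
  rewrite /h delta_mx_rshift -[zeta]hsubmxK scale_row_mx add_row_mx !row_mxKl.
  by rewrite scaler0 addr0.
have coef j : exists ab : R * R, [/\ ab.1 <= 0, ab.2 <= 0,
    ab.1 + ab.2 <= - (1 / 2),
    (c s 0 j != 0 -> ab.1 = 0) /\ (0 < mu 0 j -> ab.2 = 0) &
    forall b, M (rshift k j) b =
      - ab.1 * partial b (h j) (row_mx s mu) + ab.2 * (b == rshift k j)%:R].
  have compE : (fun x => fb_system x 0 (rshift k j)) =
      (fun zeta => fischer_burmeister (- h j zeta) (zeta 0 (rshift k j))).
    by apply/funext => zeta; rewrite row_mxEr !mxE.
  have [mu0 c0 cmu] := compl j.
  have [||||||al [be [H1 H2 H3 H4 H5]]] :=
    limiting_fb (h_indep j) (r := M (rshift k j)) (h_C1 j) z_cvg.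
  - by move=> t; rewrite -compE; exact: differentiable_component.
  - by move=> b; rewrite -compE; exact: comp_cvg.
  - by rewrite /h row_mxKl.
  - by rewrite row_mxEr.
  - by rewrite /h row_mxKl row_mxEr.
  - rewrite /h row_mxKl => /active_grad[i ci]; exists (lshift l i).
    rewrite partial_lshift; under eq_fun do rewrite row_mxKl.
    exact: ci.
  - exists (al, be); split=> //=.
    by move: H4; rewrite /h row_mxKl row_mxEr.
have [ab abP] := choice coef.
exists (\row_j (ab j).1), (\row_j (ab j).2); split.
  by move=> j; rewrite !mxE; have [] := abP j.
rewrite -[M]submxK; congr block_mx; apply/matrixP => i j.
- rewrite [LHS]mxE [LHS]mxE Mtop partial_lshift [RHS]mxE.
  (* The Jacobian of the gradient and [hess] take the two derivatives in opposite order. *)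
  rewrite -(partialC _ _ _ (C2_weighted_lagrangian mu)).
  congr (partial j _ s); apply/funext => y.
  by rewrite row_mxKl row_mxKr.
(* As a function of the multipliers alone the gradient component is affine, and its derivative in
   the multiplier [j] keeps only the [j]-th term of the sum. *)
- rewrite [LHS]mxE [LHS]mxE Mtop partial_rshift.
  rewrite mul_mx_diag [RHS]mxE [in RHS]mxE [in RHS]mxE.
  transitivity (partial j (fun mu' : 'rV[R]_l => partial i A s + \sum_a
      sg 0 a * mu' 0 a * partial i (fun s => c s 0 a) s) mu).
    congr (partial j _ mu); apply/funext => y.
    by rewrite row_mxKl row_mxKr partial_weighted_lagrangian.
  have dt (a : 'I_l) : differentiable (fun mu' : 'rV[R]_l =>
      partial i (fun s => c s 0 a) s * sg 0 a * mu' 0 a) mu.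
    by apply: differentiableZ; exact: differentiable_coord.
  rewrite (_ : (fun mu' => _) = (fun mu' : 'rV[R]_l => partial i A s +
      \sum_a partial i (fun s => c s 0 a) s * sg 0 a * mu' 0 a)); last first.
    apply/funext => y; congr (_ + _); apply: eq_bigr => a _.
    by rewrite mulrC mulrA.
  apply: etrans (partialD j _ _) _.
  + exact: differentiable_cst.
  + rewrite (_ : (fun s => _) = \sum_a (fun mu' : 'rV[R]_l =>
        partial i (fun s => c s 0 a) s * sg 0 a * mu' 0 a)).
      exact: differentiable_sum.
    by apply/funext => y; rewrite fct_sumE.
  rewrite partial_cst add0r (partial_sum j dt) (bigD1 j)//= big1 ?addr0.
    apply: etrans (partialZ _ _ (differentiable_coord _ _ _)) _.
    by rewrite partial_coord eqxx mulr1.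
  move=> a aj; apply: etrans (partialZ _ _ (differentiable_coord _ _ _)) _.
  by rewrite partial_coord eq_sym (negPf aj) mulr0.
- rewrite [LHS]mxE [LHS]mxE; have [_ _ _ _ ->] := abP i.
  rewrite eq_lrshift mulr0 addr0 partial_lshift.
  rewrite mulNmx mul_diag_mx [RHS]mxE [in RHS]mxE [in RHS]mxE [in RHS]mxE mulNr.
  congr (- (_ * _)); congr (partial j _ s); apply/funext => y.
  by rewrite /h row_mxKl.
- rewrite [LHS]mxE [LHS]mxE; have [_ _ _ _ ->] := abP i.
  rewrite partial_rshift (_ : (fun s' => _) = fun=> c s 0 i); last first.
    by apply/funext => y; rewrite /h row_mxKl.
  rewrite partial_cst mulr0 add0r eq_rshift !mxE eq_sym.
  by case: (i == j); rewrite ?mulr1 ?mulr0.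
Qed.

(** Only the lower block row involves [(al, be)], and linearly; the upper one is reproduced because
    the two weights sum to 1. *)
Lemma fb_jacobian_conv s mu al be al' be' (r : R) :
  r *: fb_jacobian s mu al be + (1 - r) *: fb_jacobian s mu al' be' =
  fb_jacobian s mu (r *: al + (1 - r) *: al') (r *: be + (1 - r) *: be').
Proof.
rewrite /fb_jacobian !scale_block_mx add_block_mx -!scalerDl addrC subrK !scale1r.
congr block_mx; last by rewrite !linearD !linearZ.
by rewrite !linearD !linearZ /= mulmxDl -!scalemxAl !mulNmx.
Qed.

Lemma convex_fb_jacobians s mu : convex_set [set M : 'M[R]_(k + l) |
  exists al be, fb_coefficients s mu al be /\ M = fb_jacobian s mu al be].
Proof.
move=> M N t; rewrite !inE => -[al [be [ab ->]]] [al' [be' [ab' ->]]].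
have r0 : 0 <= t%:num by [].
have r1 : t%:num <= 1 by [].
exists (t%:num *: al + (1 - t%:num) *: al').
exists (t%:num *: be + (1 - t%:num) *: be'); split; last exact: fb_jacobian_conv.
move: t%:num r0 r1 => {t} r r0 r1 j; rewrite !mxE.
have [a0 b0 abl [ac bm]] := ab j; have [a0' b0' abl' [ac' bm']] := ab' j.
split; [by nra|by nra|by nra|split].
- by move=> cn0; rewrite ac// ac'// !mulr0 addr0.
- by move=> m0; rewrite bm// bm'// !mulr0 addr0.
Qed.

(** With [D] the identity and [tau = sg] positive, the last hypothesis is the usual strong
    second-order condition; a general [D] allows weights of mixed sign. *)
Theorem fb_system_CD_regular (D : 'M[R]_k) (tau : 'rV[R]_l) s (mu : 'rV[R]_l) :
  (forall j, [/\ 0 <= mu 0 j, c s 0 j <= 0 & c s 0 j * mu 0 j = 0]) ->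
  (forall e : 'rV[R]_l, (forall j, c s 0 j != 0 -> e 0 j = 0) ->
    e *m constraint_jacobian s = 0 -> e = 0) ->
  (forall j, sg 0 j != 0) -> (forall j, 0 < tau 0 j) ->
  D *m (constraint_jacobian s)^T *m diag_mx sg =
    (constraint_jacobian s)^T *m diag_mx tau ->
  (forall d : 'rV[R]_k, (forall j, 0 < mu 0 j ->
      dot (grad (fun s => c s 0 j) s) d = 0) -> d != 0 ->
    0 < (d *m D *m hess (weighted_lagrangian mu) s *m d^T) 0 0) ->
  CD_regular fb_system (row_mx s mu).
Proof.
move=> compl licq sg0 tau0 DJ sosc M.
have sub : clarke_jacobian fb_system (row_mx s mu) `<=` [set M |
    exists al be, fb_coefficients s mu al be /\ M = fb_jacobian s mu al be].
  apply: smallest_sub; first exact: convex_fb_jacobians.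
  move=> N; apply: limiting_jacobians_fb_system => // j cj0.
  apply: contrapT => /forallNP gj0.
  (* A vanishing active gradient would make the unit vector [delta_mx 0 j] a nontrivial
     dependency. *)
  have /rowP/(_ j) : delta_mx 0 j = 0 :> 'rV[R]_l; last first.
    by rewrite !mxE !eqxx => /eqP; rewrite oner_eq0.
  apply: licq => [a|].
    by rewrite mxE eqxx; case: (eqVneq a j) => // ->; rewrite cj0 eqxx.
  - apply/rowP => i; rewrite -rowE !mxE; apply/eqP/negPn/negP.
    exact: gj0.
move=> /sub[al [be [ab ->]]]; apply: (saddle_unitmx (D := D) (tau := tau)) => //.
- move=> j; have [a0 b0 abl _] := ab j; split=> //.
  by apply: le_lt_trans abl _; rewrite oppr_lt0 divr_gt0.
(* A positive multiplier forces [be 0 j = 0], so the directions to be tested lie in the critical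
   subspace. *)
- move=> d Qd dn0; apply: sosc => // j mj.
  have [_ _ _ [_ /(_ mj) /Qd]] := ab j; rewrite mxE => <-.
  by rewrite /dot; apply: eq_bigr => i _; rewrite !mxE mulrC.
(* Independence is applied to [e *m diag_mx sg], supported on the active constraints because [al]
   vanishes off them; the nonzero weights are then cancelled. *)
- move=> e ae eJ; have esg : e *m diag_mx sg = 0.
    apply: licq eJ => j cj; have [_ _ _ [/(_ cj) /ae ej _]] := ab j.
    by rewrite mul_mx_diag mxE ej mul0r.
  apply/rowP => j; move/rowP: esg => /(_ j); rewrite mul_mx_diag !mxE => /eqP.
  by rewrite mulf_eq0 (negPf (sg0 j)) orbF => /eqP.
Qed.

End FBSystem.

(** * Inner products, complementarity and linear independence in coordinates *)

Section Dot.
Context {R : realType}.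

Lemma dotE k (a b : 'rV[R]_k) : dot a b = (a *m b^T) 0 0.
Proof. by rewrite mxE; apply: eq_bigr => i _; rewrite mxE. Qed.

Lemma dot_row_mx k l (a c : 'rV[R]_k) (b d : 'rV[R]_l) :
  dot (row_mx a b) (row_mx c d) = dot a c + dot b d.
Proof. by rewrite !dotE tr_row_mx mul_row_col mxE. Qed.

Lemma fb_vec_row_mx k l (a c : 'rV[R]_k) (b d : 'rV[R]_l) :
  fb_vec (row_mx a b) (row_mx c d) = row_mx (fb_vec a c) (fb_vec b d).
Proof.
by apply/rowP => j; rewrite !mxE; case: (fintype.split j) => i; rewrite mxE.
Qed.

Lemma complementary_row_mx k l (a c : 'rV[R]_k) (b d : 'rV[R]_l) :
  complementary a c -> complementary b d ->
  complementary (row_mx a b) (row_mx c d).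
Proof.
move=> [a0 c0 ac] [b0 d0 bd]; split.
- by move=> i; rewrite mxE; case: (fintype.split i).
- by move=> i; rewrite mxE; case: (fintype.split i).
- by rewrite dot_row_mx ac bd addr0.
Qed.

Lemma complementary_entry k (a b : 'rV[R]_k) j : complementary a b ->
  [/\ 0 <= a 0 j, b 0 j <= 0 & b 0 j * a 0 j = 0].
Proof.
move=> [a0 b0 ab]; split=> //; apply/eqP; rewrite mulrC -oppr_eq0.
have : \sum_i - (a 0 i * b 0 i) = 0 by rewrite sumrN [X in - X]ab oppr0.
move/eqP; rewrite psumr_eq0; last first.
  by move=> i _; rewrite oppr_ge0 mulr_ge0_le0.
by move=> /allP/(_ j); rewrite mem_index_enum => /(_ isT).
Qed.

End Dot.

(** [free] speaks of coefficients indexed by positions in a sequence; this form takes coefficients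
    indexed by [I] and supported on [A], as multiplier vectors are. *)
Lemma free_image_coef (K : fieldType) (vT : vectType K) (I : finType)
    (A : {set I}) (V : I -> vT) (e : I -> K) :
  free [seq V j | j in A] -> (forall j, j \notin A -> e j = 0) ->
  \sum_j e j *: V j = 0 -> forall j, e j = 0.
Proof.
move=> freeV e0 sum0 j; have [jA|] := boolP (j \in A); last exact: e0.
have eA : \sum_j e j *: V j = \sum_(j in A) e j *: V j.
  rewrite [LHS](bigID (mem A)) /= [X in _ + X]big1 ?addr0// => i /e0 ->.
  by rewrite scale0r.
pose X := [seq V j | j in A]; have sX : size X = size (enum A) by rewrite size_map.
(* Position [i] gets the coefficient of the [i]-th element of [enum A]; the default [j] is never
   reached. *)
have /freeP/(_ (fun i => e (nth j (enum A) i))) : free (in_tuple X) by [].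
have -> : \sum_(i < size X) e (nth j (enum A) i) *: (in_tuple X)`_i = 0.
  rewrite -(big_mkord xpredT (fun i => e (nth j (enum A) i) *: X`_i)) sX.
  rewrite -[RHS]sum0 eA -[RHS]big_enum (big_nth j).
  by apply: eq_big_nat => i /andP[_ iA]; rewrite (nth_map j).
have ij : (index j (enum A) < size X)%N by rewrite sX index_mem mem_enum.
by move=> /(_ erefl (Ordinal ij)) /=; rewrite nth_index// mem_enum.
Qed.

(** * Constraint Jacobians under stacking and linear substitution *)

Section ConstraintJacobian.
Context {R : realType}.

Lemma constraint_jacobian_row_mx k l1 l2 (a : 'rV[R]_k -> 'rV[R]_l1)
    (b : 'rV[R]_k -> 'rV[R]_l2) s :
  constraint_jacobian (fun s => row_mx (a s) (b s)) s =
  col_mx (constraint_jacobian a s) (constraint_jacobian b s).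
Proof.
apply/matrixP => j i; rewrite -(splitK j); case: (fintype.split j) => j' /=.
  rewrite col_mxEu [LHS]mxE [RHS]mxE; congr (partial i _ s).
  by apply/funext => y; rewrite row_mxEl.
rewrite col_mxEd [LHS]mxE [RHS]mxE; congr (partial i _ s).
by apply/funext => y; rewrite row_mxEr.
Qed.

Lemma constraint_jacobian_mulmxr k l l' (P : 'M[R]_(k, l))
    (c : 'rV[R]_l -> 'rV[R]_l') s : C2_vec c ->
  constraint_jacobian (fun s => c (s *m P)) s =
  constraint_jacobian c (s *m P) *m P^T.
Proof.
move=> Cc; apply/matrixP => j i; rewrite [LHS]mxE.
apply: etrans
  (@partial_mulmxr _ _ _ P (fun t => c t 0 j) i s ((Cc j).1.1 _)) _.
by rewrite [RHS]mxE; apply: eq_bigr => b _; rewrite !mxE mulrC.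
Qed.

Lemma row_constraint_jacobian k l (c : 'rV[R]_k -> 'rV[R]_l) s j :
  row j (constraint_jacobian c s) = grad (fun s => c s 0 j) s.
Proof. by apply/rowP => i; rewrite !mxE. Qed.

Lemma dot_grad_component k l (c : 'rV[R]_k -> 'rV[R]_l) s (d : 'rV[R]_k) j :
  dot (grad (fun s => c s 0 j) s) d = (constraint_jacobian c s *m d^T) j 0.
Proof. by rewrite -row_constraint_jacobian dotE -row_mul [LHS]mxE. Qed.

Lemma C2_vec_row_mx k l1 l2 (a : 'rV[R]_k -> 'rV[R]_l1)
    (b : 'rV[R]_k -> 'rV[R]_l2) :
  C2_vec a -> C2_vec b -> C2_vec (fun s => row_mx (a s) (b s)).
Proof.
move=> Ca Cb j; rewrite -(splitK j); case: (fintype.split j) => j' /=.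
  rewrite (_ : (fun _ => _) = fun s => a s 0 j'); first exact: Ca.
  by apply/funext => y; rewrite row_mxEl.
rewrite (_ : (fun _ => _) = fun s => b s 0 j'); first exact: Cb.
by apply/funext => y; rewrite row_mxEr.
Qed.

Lemma C2_vec_mulmxr k l l' (P : 'M[R]_(k, l)) (c : 'rV[R]_l -> 'rV[R]_l') :
  C2_vec c -> C2_vec (fun s => c (s *m P)).
Proof. by move=> Cc j; exact: (C2_mulmxr P (Cc j)). Qed.

End ConstraintJacobian.

(** * The bilevel system as an instance of the abstract system, and its Hessian *)

Section Bilevel.
Context {R : realType} {n m p q : nat}.
Context (F f : 'rV[R]_(n + m) -> R).
Context (G : 'rV[R]_(n + m) -> 'rV[R]_p) (g : 'rV[R]_m -> 'rV[R]_q).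
Context (lam : R).
Hypotheses (F_C2 : C2 F) (f_C2 : C2 f) (G_C2 : C2_vec G) (g_C2 : C2_vec g).

(** These matrices read [(x, y)], [y], [z] and [(x, z)] off the stacked vector [(x, y, z)]. *)
Let E12 : 'M[R]_(n + m + m, n + m) := col_mx 1%:M 0.
Let E2 : 'M[R]_(n + m + m, m) := col_mx (col_mx 0 1%:M) 0.
Let E3 : 'M[R]_(n + m + m, m) := col_mx 0 1%:M.
Let E13 : 'M[R]_(n + m + m, n + m) :=
  col_mx (col_mx (row_mx 1%:M 0) 0) (row_mx 0 1%:M).

Lemma mulmx_E12 (s : 'rV[R]_(n + m + m)) : s *m E12 = d12 s.
Proof.
by rewrite -[in LHS](hsubmxK s) mul_row_col mulmx1 mulmx0 addr0.
Qed.

Lemma mulmx_E3 (s : 'rV[R]_(n + m + m)) : s *m E3 = d3 s.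
Proof.
by rewrite -[in LHS](hsubmxK s) mul_row_col mulmx1 mulmx0 add0r.
Qed.

Lemma mulmx_E2 (s : 'rV[R]_(n + m + m)) : s *m E2 = d2 s.
Proof.
rewrite -[in LHS](hsubmxK s) -[lsubmx s]hsubmxK !mul_row_col !mulmx0 mulmx1.
by rewrite addr0 add0r.
Qed.

Lemma mulmx_E13 (s : 'rV[R]_(n + m + m)) : s *m E13 = d13 s.
Proof.
rewrite -[in LHS](hsubmxK s) -[X in row_mx X _]hsubmxK !mul_row_col mulmx0.
by rewrite addr0 !mul_mx_row !mulmx1 !mulmx0 add_row_mx addr0 add0r.
Qed.

(** This is [bigL] with all multipliers set to zero. *)
Definition objective (s : 'rV[R]_(n + m + m)) : R :=
  F (s *m E12) + lam * f (s *m E12) + - lam * f (s *m E13).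

Definition constraints (s : 'rV[R]_(n + m + m)) : 'rV[R]_(p + q + q) :=
  row_mx (row_mx (G (s *m E12)) (g (s *m E2))) (g (s *m E3)).

Definition multiplier_signs : 'rV[R]_(p + q + q) :=
  row_mx (const_mx 1) (const_mx (- lam)).

Lemma C2_objective : C2 objective.
Proof.
exact: (C2D (C2D (C2_mulmxr E12 F_C2) (C2Z lam (C2_mulmxr E12 f_C2)))
            (C2Z (- lam) (C2_mulmxr E13 f_C2))).
Qed.

Lemma C2_constraints : C2_vec constraints.
Proof.
exact: (C2_vec_row_mx (C2_vec_row_mx (C2_vec_mulmxr E12 G_C2)
  (C2_vec_mulmxr E2 g_C2)) (C2_vec_mulmxr E3 g_C2)).
Qed.

Lemma bigLE u v w s :
  weighted_lagrangian objective constraints multiplier_signs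
    (row_mx (row_mx u v) w) s =
  bigL F f G g lam (lsubmx (lsubmx s)) (rsubmx (lsubmx s)) (rsubmx s) u v w.
Proof.
rewrite /weighted_lagrangian /bigL /calL /ell /objective /constraints.
rewrite mulmx_E12 mulmx_E13 mulmx_E2 mulmx_E3 /d12 /d13 /d2 /d3 hsubmxK.
rewrite !big_split_ord /=.
have -> : \sum_(i < p) multiplier_signs 0 (lshift q (lshift q i)) *
    row_mx (row_mx u v) w 0 (lshift q (lshift q i)) *
    row_mx (row_mx (G (lsubmx s)) (g (rsubmx (lsubmx s)))) (g (rsubmx s)) 0
      (lshift q (lshift q i)) = dot u (G (lsubmx s)).
  by apply: eq_bigr => i _; rewrite !row_mxEl mxE mul1r.
have -> : \sum_(i < q) multiplier_signs 0 (lshift q (rshift p i)) *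
    row_mx (row_mx u v) w 0 (lshift q (rshift p i)) *
    row_mx (row_mx (G (lsubmx s)) (g (rsubmx (lsubmx s)))) (g (rsubmx s)) 0
      (lshift q (rshift p i)) = dot v (g (rsubmx (lsubmx s))).
  by apply: eq_bigr => i _; rewrite !row_mxEl !row_mxEr mxE mul1r.
have -> : \sum_(i < q) multiplier_signs 0 (rshift (p + q) i) *
    row_mx (row_mx u v) w 0 (rshift (p + q) i) *
    row_mx (row_mx (G (lsubmx s)) (g (rsubmx (lsubmx s)))) (g (rsubmx s)) 0
      (rshift (p + q) i) = - lam * dot w (g (rsubmx s)).
  rewrite mulr_sumr.
  by apply: eq_bigr => i _; rewrite !row_mxEr mxE mulrA.
by ring.
Qed.

Lemma PhiE : Phi F f G g lam = fb_system objective constraints multiplier_signs.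
Proof.
apply/funext => zeta; rewrite /Phi /fb_system.
set s := lsubmx zeta; set mu := rsubmx zeta.
congr row_mx.
  rewrite /grad_bigL !hsubmxK; congr (grad _ s); apply/funext => y.
  by rewrite -bigLE !hsubmxK.
rewrite hsubmxK; have muE : mu =
    row_mx (row_mx (lsubmx (lsubmx mu)) (rsubmx (lsubmx mu))) (rsubmx mu).
  by rewrite !hsubmxK.
apply: etrans _ (congr1 (fb_vec (constraints s)) (esym muE)).
by rewrite /constraints mulmx_E12 mulmx_E2 mulmx_E3 !fb_vec_row_mx.
Qed.

(** The block-diagonal shape reflects that the first two groups of constraints involve only [(x, y)]
    and the third only [z]; a sign change of the [z] block therefore acts on the third group
    alone. *)
Lemma constraint_jacobian_constraints s :
  constraint_jacobian constraints s =
  block_mx (col_mx (constraint_jacobian G (d12 s))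
                   (row_mx 0 (constraint_jacobian g (d2 s)))) 0
           0 (constraint_jacobian g (d3 s)).
Proof.
rewrite /constraints !constraint_jacobian_row_mx.
rewrite !constraint_jacobian_mulmxr// mulmx_E12 mulmx_E2 mulmx_E3.
rewrite !tr_col_mx !trmx0 !trmx1 !mul_mx_row !mulmx1 !mulmx0.
rewrite block_mxEv; congr col_mx.
by rewrite -block_mxEv block_mxEh col_mx0.
Qed.

Let ell_fun (w : 'rV[R]_q) (t : 'rV[R]_(n + m)) : R :=
  ell f g (lsubmx t) (rsubmx t) w.

Lemma C2_dot l k (a : 'rV[R]_k) (c : 'rV[R]_l -> 'rV[R]_k) :
  C2_vec c -> C2 (fun t => dot a (c t)).
Proof. by move=> Cc; exact: (C2_sum (fun j => C2Z (a 0 j) (Cc j))). Qed.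

Let g_rsub_C2 : C2_vec (fun t : 'rV[R]_(n + m) => g (rsubmx t)).
Proof.
rewrite (_ : (fun t => _) = fun t => g (t *m col_mx 0 1%:M)).
  exact: C2_vec_mulmxr.
apply/funext => t; congr g.
by rewrite -[in RHS](hsubmxK t) mul_row_col mulmx1 mulmx0 add0r.
Qed.

Lemma C2_ell w : C2 (ell_fun w).
Proof.
rewrite (_ : ell_fun w = fun t => f t + dot w (g (rsubmx t))).
  exact: (C2D f_C2 (C2_dot w g_rsub_C2)).
by apply/funext => t; rewrite /ell_fun /ell hsubmxK.
Qed.

Lemma C2_calL u v :
  C2 (fun t : 'rV[R]_(n + m) => calL F f G g lam (lsubmx t) (rsubmx t) u v).
Proof.
rewrite (_ : (fun t => _) = fun t : 'rV[R]_(n + m) =>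
  F t + dot u (G t) + dot v (g (rsubmx t)) + lam * f t).
  exact: (C2D (C2D (C2D F_C2 (C2_dot u G_C2)) (C2_dot v g_rsub_C2))
              (C2Z lam f_C2)).
by apply/funext => t; rewrite /calL hsubmxK.
Qed.

(** The nonsymmetric matrix of the second-order condition is the ordinary Hessian of [ell] with its
    [z] rows negated, which matches the sign change in the test direction. *)
Lemma hess_ell_starE x z w : hess_ell_star f g x z w =
  block_mx 1%:M 0 0 (- 1%:M) *m hess (ell_fun w) (row_mx x z).
Proof.
rewrite -[hess (ell_fun w) _]submxK mulmx_block !mul0mx !mul1mx !addr0 !add0r.
rewrite !mulNmx !mul1mx.
have E12l i k : hess (ell_fun w) (row_mx x z) (rshift n i) (lshift m k) =
    hess12_ell f g x z w i k.
  rewrite [LHS]mxE partial_rshift [RHS]mxE; congr (partial i _ z).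
  apply/funext => z'; rewrite partial_lshift; congr (partial k _ x).
  by apply/funext => x'; rewrite /ell_fun row_mxKl row_mxKr.
congr block_mx.
- apply/matrixP => i k; rewrite [LHS]mxE [RHS]mxE [RHS]mxE [RHS]mxE.
  rewrite partial_lshift; congr (partial i _ x).
  apply/funext => x'; rewrite partial_lshift; congr (partial k _ x').
  by apply/funext => x''; rewrite /ell_fun row_mxKl row_mxKr.
(* [hess21_ell] is defined as a transpose, so this block needs the symmetry of the Hessian. *)
- apply/matrixP => i k; rewrite [LHS]mxE -E12l [RHS]mxE [RHS]mxE.
  by rewrite -[in RHS](hess_sym _ (C2_ell w)) [RHS]mxE.
- by congr (- _); apply/matrixP => i k; rewrite -E12l [RHS]mxE [RHS]mxE.
- congr (- _); apply/matrixP => i k; rewrite [LHS]mxE [RHS]mxE [RHS]mxE [RHS]mxE.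
  rewrite partial_rshift; congr (partial i _ z).
  apply/funext => z'; rewrite partial_rshift; congr (partial k _ z').
  by apply/funext => z''; rewrite /ell_fun row_mxKl row_mxKr.
Qed.

(** The Lagrangian splits into [calL] in [(x, y)] and [- lam * ell] in [(x, z)]. Negating the [z]
    block leaves the first form unchanged and replaces the left factor [(d1, d3)] of the second by
    [(d1, - d3)], which is what [hess_ell_star] encodes. *)
Lemma quad_lagrangian x y z u v w (d : 'rV[R]_(n + m + m)) :
  (d *m block_mx 1%:M 0 0 (- 1%:M) *m
   hess (weighted_lagrangian objective constraints multiplier_signs
     (row_mx (row_mx u v) w)) (row_mx (row_mx x y) z) *m d^T) 0 0 =
  quad (hess_calL F f G g lam x y u v) (d12 d)
  - lam * quad (hess_ell_star f g x z w) (d13 d).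
Proof.
have -> : weighted_lagrangian objective constraints multiplier_signs
    (row_mx (row_mx u v) w) = fun s =>
    calL F f G g lam (lsubmx (s *m E12)) (rsubmx (s *m E12)) u v +
    - lam * ell_fun w (s *m E13).
  apply/funext => s; rewrite bigLE /bigL /ell_fun mulmx_E12 mulmx_E13.
  by rewrite /d13 row_mxKl row_mxKr mulNr.
rewrite (hessD _ (C2_mulmxr E12 (C2_calL u v))
  (C2Z (- lam) (C2_mulmxr E13 (C2_ell w)))).
rewrite (hessZ _ _ (C2_mulmxr E13 (C2_ell w))).
rewrite (hess_mulmxr E12 _ (C2_calL u v)) (hess_mulmxr E13 _ (C2_ell w)).
rewrite mulmx_E12 mulmx_E13 /d12 /d13 !row_mxKl row_mxKr.
rewrite mulmxDr mulmxDl [LHS]mxE; congr (_ + _).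
  rewrite /quad /hess_calL !mulmxA mulmx_E12 /d12 -(mulmxA _ E12^T) -trmx_mul.
  rewrite mulmx_E12 /d12; congr ((_ *m _ *m _) 0 0).
  rewrite -[in LHS](hsubmxK d) mul_row_block row_mxKl.
  by rewrite mulmx1 mulmx0 addr0.
rewrite -scalemxAr -scalemxAl [LHS]mxE mulNr; congr (- (_ * _)).
rewrite /quad hess_ell_starE !mulmxA mulmx_E13 -(mulmxA _ E13^T) -trmx_mul.
rewrite mulmx_E13 /d13; congr ((_ *m _ *m _) 0 0).
rewrite -[in LHS](hsubmxK d) !mul_row_block row_mxKl row_mxKr.
by rewrite !mulmx1 !mulmx0 !addr0 !add0r.
Qed.

End Bilevel.

(** * Linear independence of the stacked active gradients *)

Section Qualification.
Context {R : realType} {n m p q : nat}.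
Context (G : 'rV[R]_(n + m) -> 'rV[R]_p) (g : 'rV[R]_m -> 'rV[R]_q).

Lemma LLICQ_coef y (e : 'rV[R]_q) : LLICQ g y ->
  (forall j, g y 0 j != 0 -> e 0 j = 0) ->
  e *m constraint_jacobian g y = 0 -> e = 0.
Proof.
move=> licq ea; rewrite mulmx_sum_row => sum0; apply/rowP => j; rewrite mxE.
apply: (free_image_coef licq) => [i|]; first by rewrite inE; exact: ea.
by rewrite -[RHS]sum0; apply: eq_bigr => i _; rewrite row_constraint_jacobian.
Qed.

Lemma upper_x_LICQ_coef x y (e : 'rV[R]_p) : upper_x_LICQ G x y ->
  (forall j, G (row_mx x y) 0 j != 0 -> e 0 j = 0) ->
  lsubmx (e *m constraint_jacobian G (row_mx x y)) = 0 -> e = 0.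
Proof.
move=> licq ea; rewrite mulmx_sum_row linear_sum => sum0.
apply/rowP => j; rewrite mxE.
apply: (free_image_coef licq) => [i|]; first by rewrite inE; exact: ea.
rewrite -[RHS]sum0; apply: eq_bigr => i _; rewrite linearZ; congr (_ *: _).
by apply/rowP => k; rewrite !mxE partial_lshift.
Qed.

(** The system is triangular. The [z] columns isolate [ew]; the [x] columns contain only [G],
    because [g] does not depend on [x], and give [eu = 0]; the [y] columns then reduce to [g] and
    give [ev = 0]. *)
Lemma constraints_licq x y z (e : 'rV[R]_(p + q + q)) :
  upper_x_LICQ G x y -> LLICQ g y -> LLICQ g z ->
  C2_vec G -> C2_vec g ->
  let s := row_mx (row_mx x y) z in
  (forall j, constraints G g s 0 j != 0 -> e 0 j = 0) ->
  e *m constraint_jacobian (constraints G g) s = 0 -> e = 0.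
Proof.
move=> licq_x llicq_y llicq_z G_C2 g_C2 s.
rewrite constraint_jacobian_constraints// /constraints.
rewrite mulmx_E12 mulmx_E2 mulmx_E3 /d12 /d2 /d3 /s !row_mxKl !row_mxKr.
rewrite -[e]hsubmxK -[lsubmx e]hsubmxK.
set eu := lsubmx (lsubmx e); set ev := rsubmx (lsubmx e); set ew := rsubmx e.
move=> ea; rewrite mul_row_block !mulmx0 addr0 add0r -row_mx0.
move=> /eq_row_mx[top ew0].
have -> : ew = 0.
  apply: LLICQ_coef llicq_z _ ew0 => j gj.
  by have := ea (rshift _ j); rewrite !row_mxEr; exact.
have eu0 : eu = 0.
  apply: upper_x_LICQ_coef licq_x _ _ => [j Gj|].
    by have := ea (lshift _ (lshift _ j)); rewrite !row_mxEl; exact.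
  have := congr1 lsubmx top; rewrite mul_row_col mul_mx_row mulmx0 linearD /=.
  by rewrite row_mxKl addr0 linear0.
have -> : ev = 0.
  apply: LLICQ_coef llicq_y _ _ => [j gj|].
    by have := ea (lshift _ (rshift _ j)); rewrite !row_mxEl !row_mxEr; exact.
  have := congr1 rsubmx top; rewrite eu0 mul_row_col mul_mx_row mul0mx add0r.
  by rewrite row_mxKr linear0.
by rewrite eu0 !row_mx0.
Qed.

End Qualification.

(** * Verification of the abstract hypotheses for the bilevel data *)

Theorem theorem5p3 (R : realType) (n m p q : nat)
    (F f : 'rV[R]_(n + m) -> R)
    (G : 'rV[R]_(n + m) -> 'rV[R]_p) (g : 'rV[R]_m -> 'rV[R]_q)
    (F_C2 : C2 F) (f_C2 : C2 f) (G_C2 : C2_vec G) (g_C2 : C2_vec g)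
    (lam : R) (lam_gt0 : 0 < lam)
    (x : 'rV[R]_n) (y z : 'rV[R]_m) (u : 'rV[R]_p) (v w : 'rV[R]_q)
    (stat : stationary F f G g lam x y z u v w)
    (licq_x : upper_x_LICQ G x y)
    (llicq_y : LLICQ g y) (llicq_z : LLICQ g z)
    (sosc : forall d : 'rV[R]_(n + m + m),
       Qset G g x y z u v w d -> d <> 0 ->
       quad (hess_calL F f G g lam x y u v) (d12 d)
         > lam * quad (hess_ell_star f g x z w) (d13 d)) :
  CD_regular (Phi F f G g lam) (zeta_vec x y z u v w).
Proof.
have [_ complG complgy complgz] := stat.
rewrite PhiE /zeta_vec; set s := row_mx (row_mx x y) z.
have consE : constraints G g s = row_mx (row_mx (G (row_mx x y)) (g y)) (g z).
  by rewrite /constraints mulmx_E12 mulmx_E2 mulmx_E3 /d12 /d2 /d3 /s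
    !row_mxKl !row_mxKr.
(* [D] sends [(d1, d2, d3)] to [(d1, d2, - d3)], and [tau] holds the absolute values of the weights
   [(1, 1, - lam)]. *)
apply: (fb_system_CD_regular (C2_objective lam F_C2 f_C2)
  (C2_constraints G_C2 g_C2) (D := block_mx 1%:M 0 0 (- 1%:M))
  (tau := row_mx (const_mx 1) (const_mx lam))).
- move=> j; apply: complementary_entry; rewrite consE.
  by do 2![apply: complementary_row_mx => //].
- by move=> e; exact: constraints_licq.
- move=> j; rewrite mxE; case: (fintype.split j) => i; rewrite mxE ?oner_eq0//.
  by rewrite oppr_eq0 gt_eqF.
- by move=> j; rewrite mxE; case: (fintype.split j) => i; rewrite mxE.
- rewrite constraint_jacobian_constraints// /multiplier_signs !diag_mx_row.
  rewrite !diag_const_mx tr_block_mx !trmx0 !mulmx_block.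
  rewrite !(mulmx0, mul0mx, addr0, add0r, mul1mx, mulmx1).
  by rewrite mulNmx mul1mx !mul_mx_scalar scaleNr scalerN opprK.
- move=> d Qd dn0; rewrite quad_lagrangian// subr_gt0; apply: sosc; last first.
    exact/eqP.
  (* It remains to see that [d] lies in [Qset]: its three conditions are the blocks of orthogonality
     to every constraint gradient with a positive multiplier. *)
  have Qd' j : 0 < row_mx (row_mx u v) w 0 j ->
      (constraint_jacobian (constraints G g) s *m d^T) j 0 = 0.
    by rewrite -dot_grad_component; exact: Qd.
  have prod : constraint_jacobian (constraints G g) s *m d^T =
      col_mx (col_mx (constraint_jacobian G (row_mx x y) *m (d12 d)^T)
                     (constraint_jacobian g y *m (d2 d)^T))
             (constraint_jacobian g z *m (d3 d)^T).
    rewrite constraint_jacobian_constraints// /d12 /d2 /d3 /s !row_mxKl !row_mxKr.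
    rewrite -[in LHS](hsubmxK d) tr_row_mx mul_block_col !mul0mx addr0 add0r.
    rewrite mul_col_mx; congr (col_mx (col_mx _ _) _).
    rewrite -[in LHS](hsubmxK (lsubmx d)) tr_row_mx mul_row_col mul0mx.
    by rewrite add0r.
  split=> i; rewrite inE => /andP[i0 _].
  - have := Qd' (lshift _ (lshift _ i)).
    by rewrite prod !row_mxEl !col_mxEu dot_grad_component; exact.
  - have := Qd' (lshift _ (rshift _ i)).
    by rewrite prod row_mxEl row_mxEr col_mxEu col_mxEd dot_grad_component; exact.
  - have := Qd' (rshift _ i).
    by rewrite prod row_mxEr col_mxEd dot_grad_component; exact.
Qed.
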